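(* Let $G_1$, $G_2$ and $G_3$ be three pairwise disjoint connected graphs and let $x_i\in V(G_i)$ for $i\in\{1,2,3\}$. Let $B(G_1,G_2,G_3)$ be the bouquet of the graphs $G_1,G_2,G_3$ with respect to the vertices $x_1,x_2,x_3$, i.e. the graph obtained from the disjoint union of $G_1,G_2,G_3$ by identifying $x_1,x_2,x_3$ to a single vertex. Then $$\gamma_{sp}(G_1)+\gamma_{sp}(G_2)+\gamma_{sp}(G_3)-2\leq \gamma_{sp}(B(G_1,G_2,G_3))\leq \gamma_{sp}(G_1)+\gamma_{sp}(G_2)+\gamma_{sp}(G_3).$$
   Context: All graphs are finite, simple and undirected. $N(v)$ denotes the open neighbourhood of $v$. For a graph $G=(V,E)$ and $S\subseteq V$ write $\overline{S}=V\setminus S$. A set $S\subseteq V$ is dominating if every vertex of $\overline{S}$ is adjacent to at least one vertex of $S$. A dominating set $S$ is a super dominating set of $G$ if for every $u\in\overline{S}$ there exists $w\in S$ with $N(w)\cap\overline{S}=\{u\}$. The super domination number $\gamma_{sp}(G)$ is the minimum cardinality of a super dominating set of $G$. *)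

(* Defs.v *)
From HB Require Import structures.
From mathcomp Require Import all_boot.

Set Implicit Arguments.
Unset Strict Implicit.
Unset Printing Implicit Defensive.

Record sgraph := SGraph {
  vertex :> finType;
  adj : rel vertex;
  adj_sym : symmetric adj;
  adj_irr : irreflexive adj }.

Definition nbh (G : sgraph) (v : G) : {set G} := [set w | adj v w].

Definition connected_graph (G : sgraph) : Prop :=
  0 < #|G| /\ forall u v : G, connect (@adj G) u v.

Definition dominating (G : sgraph) (S : {set G}) : bool :=
  [forall u in ~: S, exists w in S, adj u w].

Definition super_dominating (G : sgraph) (S : {set G}) : bool :=
  dominating S && [forall u in ~: S, exists w in S, nbh w :&: ~: S == [set u]].

(* The whole vertex set is always super dominating, so the arg min ranges over
   a nonempty family (see super_dominatingT). *)
Definition gamma_sp (G : sgraph) : nat :=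
  #|[arg min_(S < [set: G] | super_dominating S) #|S|]|.

Lemma super_dominatingT (G : sgraph) : super_dominating [set: G].
Proof. by apply/andP; split; apply/forall_inP => u; rewrite setCT inE. Qed.

Section DisjointUnion.
Variables G H : sgraph.

Definition dunion_adj : rel (G + H) := fun a b =>
  match a, b with
  | inl u, inl v => adj u v
  | inr u, inr v => adj u v
  | _, _ => false
  end.

Lemma dunion_adj_sym : symmetric dunion_adj.
Proof. by move=> [u|u] [v|v] //=; rewrite adj_sym. Qed.

Lemma dunion_adj_irr : irreflexive dunion_adj.
Proof. by move=> [u|u] /=; rewrite adj_irr. Qed.

Definition dunion : sgraph := SGraph dunion_adj_sym dunion_adj_irr.
End DisjointUnion.

(* Identification of all vertices of A to the single vertex None; the other
   vertices are kept as Some v.  Edges are the images of the edges of G, minus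
   the loop at None that arises only if A contains two adjacent vertices. *)
Section Identify.
Variables (G : sgraph) (A : {set G}).

Definition identify_vertex : finType := option {v : G | v \notin A}.

Definition identify_proj (v : G) : identify_vertex := insub v.

Definition identify_adj : rel identify_vertex := fun u v =>
  (u != v) && [exists a : G, exists b : G,
    [&& identify_proj a == u, identify_proj b == v & adj a b]].

Lemma identify_adj_sym : symmetric identify_adj.
Proof.
move=> u v; rewrite /identify_adj eq_sym; congr (_ && _).
by apply/existsP/existsP => -[a /existsP[b /and3P[pa pb ab]]];
  exists b; apply/existsP; exists a; rewrite pa pb adj_sym.
Qed.

Lemma identify_adj_irr : irreflexive identify_adj.
Proof. by move=> u; rewrite /identify_adj eqxx. Qed.

Definition identify : sgraph := SGraph identify_adj_sym identify_adj_irr.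
End Identify.

Definition bouquet3 (G1 G2 G3 : sgraph) (x1 : G1) (x2 : G2) (x3 : G3) : sgraph :=
  @identify (dunion (dunion G1 G2) G3)
    [set inl (inl x1); inl (inr x2); inr x3].

(* Main.v *)
Require Import Defs.
From mathcomp Require Import all_boot.
From mathcomp Require Import zify.

(** If [S] is super dominating and [w u] is a vertex of [S] with
    [N(w u) \ S = {u}] for every [u] outside [S], then the pairs [(u, w u)]
    satisfy "[u ~ w u'] iff [u = u']".  Conversely the first components of any
    such family of pairs have a super dominating complement, so
    [gamma_sp G = |V(G)| - m(G)] with [m(G)] the largest size of such a family,
    and the condition is invariant under exchanging the components of all pairs.

    A family of pairs in a bouquet splits into families in its parts, which gives
    the lower bound.  For the upper bound, take optimal families in the parts,
    exchanged so that the identified vertex is never a second component.  If it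
    is uncovered in some part, drop the pair covering it in all the others;
    otherwise keep that pair in one part only. *)

Set Implicit Arguments.
Unset Strict Implicit.
Unset Printing Implicit Defensive.

(** * Super domination in terms of cross matchings *)

(** The clause [p.1 != q.2] keeps all second components in the complement of the first ones, which
    is to be the set [S]. *)
Definition cross_matching (G : sgraph) (M : {set G * G}) : Prop :=
  forall p q, p \in M -> q \in M ->
    adj p.1 q.2 = (p == q) /\ p.1 != q.2.

Lemma super_dominatingP (G : sgraph) (S : {set G}) :
  reflect (forall u, u \notin S -> exists2 w, w \in S & nbh w :&: ~: S = [set u])
          (super_dominating S).
Proof.
apply: (iffP andP) => [[_ /forall_inP H] u uS | H].
  have /H/exists_inP[w wS /eqP E] : u \in ~: S by rewrite inE.
  by exists w.
split; apply/forall_inP => u; rewrite inE => /H[w wS E]; apply/exists_inP;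
  exists w => //; last by rewrite E.
by have := set11 u; rewrite -E !inE adj_sym => /andP[].
Qed.

Lemma gamma_sp_le (G : sgraph) (S : {set G}) :
  super_dominating S -> gamma_sp G <= #|S|.
Proof.
rewrite /gamma_sp; case: arg_minnP => [|T _ minT]; last exact: minT.
exact: super_dominatingT.
Qed.

Lemma gamma_sp_attained (G : sgraph) :
  exists2 S : {set G}, super_dominating S & #|S| = gamma_sp G.
Proof.
rewrite /gamma_sp; case: arg_minnP => [|S sdS _]; first exact: super_dominatingT.
by exists S.
Qed.

Lemma cross_matching_fst_inj (G : sgraph) (M : {set G * G}) :
  cross_matching M -> {in M &, injective fst}.
Proof.
move=> cM p q pM qM eq1; apply/esym/eqP.
by rewrite -(cM q p qM pM).1 -eq1 (cM p p pM pM).1.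
Qed.

Lemma gamma_sp_cross_matching_le (G : sgraph) (M : {set G * G}) :
  cross_matching M -> gamma_sp G + #|M| <= #|G|.
Proof.
move=> cM; rewrite -(cardsC (fst @: M)) addnC.
rewrite (card_in_imset (cross_matching_fst_inj cM)) leq_add2l.
apply/gamma_sp_le/super_dominatingP => u; rewrite inE negbK => /imsetP[p pM ->].
exists p.2.
  by rewrite inE; apply/imsetP => -[q qM eq2]; case: (cM q p qM pM); rewrite eq2 eqxx.
apply/setP => v; rewrite !inE negbK; apply/andP/eqP => [[pv /imsetP[q qM ev]] | ->].
  by move: pv; rewrite ev adj_sym (cM q p qM pM).1 => /eqP->.
by rewrite adj_sym (cM p p pM pM).1 eqxx imset_f.
Qed.

Lemma gamma_sp_cross_matching_ex (G : sgraph) :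
  exists2 M : {set G * G}, cross_matching M & gamma_sp G + #|M| = #|G|.
Proof.
have [S /super_dominatingP sdS <-] := gamma_sp_attained G.
(* The default [u] is never reached for [u] outside [S], as [wP] shows. *)
pose w u := odflt u [pick v in S | nbh v :&: ~: S == [set u]].
have wP u : u \notin S -> w u \in S /\ nbh (w u) :&: ~: S = [set u].
  move=> /sdS[v vS E]; rewrite /w; case: pickP => [z /andP[zS /eqP] // |].
  by move/(_ v); rewrite vS E eqxx.
exists [set (u, w u) | u in ~: S]; last first.
  by rewrite card_imset ?cardsC // => u v [].
move=> _ _ /imsetP[u uS ->] /imsetP[v vS ->] /=.
move: uS vS; rewrite !inE => uS /wP[wvS /setP/(_ u)].
rewrite !inE uS andbT adj_sym => ->; split.
  by apply/eqP/eqP => [->|[]].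
by apply: contraNneq uS => ->.
Qed.

Lemma cross_matching_swap (G : sgraph) (M : {set G * G}) :
  cross_matching M -> cross_matching (@swap_pair G G @: M).
Proof.
move=> cM _ _ /imsetP[p pM ->] /imsetP[q qM ->]; have [e ne] := cM q p qM pM.
by rewrite (inj_eq (can_inj swap_pairK)) eq_sym -e adj_sym eq_sym.
Qed.

(** A vertex that occurs as a second component is never a first component, so exchanging all pairs
    removes [x] from the second components. *)
Lemma gamma_sp_cross_matching_avoid (G : sgraph) (x : G) :
  exists M : {set G * G}, [/\ cross_matching M, gamma_sp G + #|M| = #|G|
    & forall p, p \in M -> p.2 != x].
Proof.
have [M cM cardM] := gamma_sp_cross_matching_ex G.
have [/existsP[p /andP[pM /eqP px]] | noM] := boolP [exists p in M, p.2 == x].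
  exists (@swap_pair G G @: M); split; first exact: cross_matching_swap.
    by rewrite (card_imset _ (can_inj swap_pairK)).
  by move=> _ /imsetP[q qM ->]; rewrite -px; exact: (cM q p qM pM).2.
exists M; split => // p pM; apply: contra noM => px.
by apply/existsP; exists p; rewrite pM.
Qed.

(** * Bouquets of a finite family of graphs, given by embeddings of the parts *)

Section Bouquet.
Variables (I : finType) (G : I -> sgraph) (x : forall i, G i) (B : sgraph).
Variables (f : forall i, G i -> B) (c : B).
Hypotheses (f_inj : forall i, injective (@f i))
  (f_adj : forall i (a b : G i), adj (f a) (f b) = adj a b)
  (f_center : forall i, f (x i) = c)
  (f_meet : forall i j (a : G i) (b : G j), i != j -> f a = f b -> a = x i)
  (f_edge : forall u v : B, adj u v ->
     exists i (a b : G i), u = f a /\ v = f b).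

Let f2 i (p : G i * G i) : B * B := (f p.1, f p.2).

Let f2_inj i : injective (@f2 i).
Proof. by move=> [a b] [a' b'] [/f_inj-> /f_inj->]. Qed.

(** The edge comes from one part [k]; an endpoint given in a part other than [k] lies in two parts,
    hence is the centre. *)
Lemma bouquet_cross_adj i j (a : G i) (b : G j) :
  i != j -> adj (f a) (f b) -> a = x i \/ b = x j.
Proof.
move=> ij /f_edge[k [a' [b' [ea eb]]]].
have [ik | ik] := eqVneq i k; last by left; exact: f_meet ik ea.
by right; apply: f_meet eb; rewrite -ik eq_sym.
Qed.

(** The cardinality hypothesis expresses that [#|I|] roots become one vertex. Splitting [M] over the
    parts loses no pair, so the gap [#|I| - 1] stems from the vertex count alone. *)
Lemma bouquet_gamma_sp_ge :
  #|B| + #|I| = (\sum_i #|G i|).+1 ->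
  \sum_i gamma_sp (G i) + 1 <= gamma_sp B + #|I|.
Proof.
move=> cardB; have [M cM cardM] := gamma_sp_cross_matching_ex B.
pose N i := @f2 i @^-1: M.
have cN i : cross_matching (N i).
  move=> p q; rewrite !inE => pM qM; have [/= e ne] := cM _ _ pM qM.
  rewrite -f_adj e (inj_eq (@f2_inj i)); split=> //.
  by apply: contraNneq ne => ->.
have MN : M \subset \bigcup_i (@f2 i @: N i).
  apply/subsetP => p pM.
  have /f_edge[i [a [b [e1 e2]]]] : adj p.1 p.2 by rewrite (cM p p pM pM).1.
  have ep : p = f2 (a, b) by rewrite /f2 /= -e1 -e2 -surjective_pairing.
  by apply/bigcupP; exists i => //; rewrite ep imset_f // inE -ep.
have leM : #|M| <= \sum_i #|N i|.
  apply: leq_trans (subset_leq_card MN) _.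
  apply: (big_rec2 (fun (A : {set B * B}) n => #|A| <= n)) => [|i n A _ leA].
    by rewrite cards0.
  rewrite (leq_trans (leq_card_setU _ _)) // leq_add //.
  exact: leq_imset_card.
have : \sum_i gamma_sp (G i) + \sum_i #|N i| <= \sum_i #|G i|.
  by rewrite -big_split; apply: leq_sum => i _; exact: gamma_sp_cross_matching_le.
lia.
Qed.

Lemma bouquet_gamma_sp_le :
  0 < #|I| -> #|B| + #|I| = (\sum_i #|G i|).+1 ->
  gamma_sp B <= \sum_i gamma_sp (G i).
Proof.
move=> /card_gt0P[k _] cardB.
have [M MP] := fin_all_exists (fun i => gamma_sp_cross_matching_avoid (x i)).
pose covered i := [exists p in M i, p.1 == x i].
(* [i0] is a part with uncovered root if there is one, and arbitrary otherwise. In the first case no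
   [N i] below covers its root, in the second only [N i0] does. *)
have [i0 i0P] : exists i0, covered i0 -> forall i, covered i.
  have [/forallP cov | /forallPn[i ncov]] := boolP [forall i, covered i].
    by exists k.
  by exists i; rewrite (negbTE ncov).
pose N i := [set p in M i | (i == i0) || (p.1 != x i)].
have NP i p : p \in N i -> p \in M i /\ (i != i0 -> p.1 != x i).
  by rewrite inE; case: eqVneq => _ /andP[].
(* First components are distinct, so at most one pair is dropped in each part other than [i0]. *)
have cardN i : #|M i| <= #|N i| + (i != i0).
  have [ei|ii0] := eqVneq i i0.
    by rewrite addn0 subset_leq_card //; apply/subsetP => p; rewrite inE (introT eqP ei) => ->.
  rewrite -(cardsID (N i) (M i)) leq_add ?subset_leq_card ?subsetIr //.
  apply/card_le1_eqP => p q; rewrite !inE (negbTE ii0) /=.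
  case: (p \in M i) / idP => pM; rewrite ?andbF // andbT negbK => /eqP px.
  case: (q \in M i) / idP => qM; rewrite ?andbF // andbT negbK => /eqP qx.
  by have [/cross_matching_fst_inj inj _ _] := MP i; apply: inj => //; rewrite px.
pose U := \bigcup_i (@f2 i @: N i).
have snd_x i p : p \in N i -> p.2 != x i.
  by move=> /NP[pM _]; have [_ _] := MP i; apply.
have cardU : #|U| = \sum_i #|N i|.
  rewrite -sum1_card partition_disjoint_bigcup => [|i j ij].
    by apply: eq_bigr => i _; rewrite sum1_card (card_imset _ (@f2_inj i)).
  rewrite disjoint_subset; apply/subsetP => _ /imsetP[p pN ->]; rewrite inE.
  (* A pair common to two parts would have the centre as second component. *)
  apply/imsetP => -[q qN [_ /(f_meet ij) e]].
  by move: (snd_x i p pN); rewrite e eqxx.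
have cU : cross_matching U.
  move=> _ _ /bigcupP[i _ /imsetP[p pN ->]] /bigcupP[j _ /imsetP[q qN ->]].
  have [ij | ij] := eqVneq i j.
    subst j; have [pM _] := NP i p pN; have [qM _] := NP i q qN.
    have [cM _ _] := MP i; have [e ne] := cM p q pM qM.
    by rewrite f_adj e (inj_eq (@f2_inj i)) (inj_eq (@f_inj i)).
  have ji : j != i by rewrite eq_sym.
  have q2x := snd_x j q qN; split; last first.
    by apply: contraNneq q2x => /esym/(f_meet ji)->.
  have -> : (f2 p == f2 q) = false.
    apply/eqP => -[_ /(f_meet ij) e].
    by move: (snd_x i p pN); rewrite e eqxx.
  (* Since [q.2] is not the root, [p.1] is, so [i = i0] and every root is covered. The pair [r]
     covering [x j] is then adjacent to [q.2], which forces [r = q]; but that pair was dropped from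
     [N j]. *)
  apply/negP => /= pq; have [p1x | /eqP] := bouquet_cross_adj ij pq; last first.
    by rewrite (negbTE q2x).
  have [pM pi0] := NP i p pN; have [qM qj0] := NP j q qN.
  have ei : i = i0 by apply/eqP/negPn/negP => /pi0; rewrite p1x eqxx.
  have /i0P/(_ j)/existsP[r /andP[rM /eqP r1x]] : covered i0.
    by rewrite -ei; apply/existsP; exists p; rewrite pM p1x /=.
  have [cM _ _] := MP j.
  move: pq; rewrite p1x f_center -(f_center j) f_adj -r1x (cM r q rM qM).1.
  by move=> /eqP erq; move: qj0; rewrite -erq r1x eqxx -ei => /(_ ji).
(* The at most [#|I| - 1] dropped pairs are balanced by the [#|I| - 1] vertices lost in the
   identification. *)
have := gamma_sp_cross_matching_le cU; rewrite cardU.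
have : \sum_i gamma_sp (G i) + \sum_i #|M i| = \sum_i #|G i|.
  by rewrite -big_split; apply: eq_bigr => i _; have [] := MP i.
have : \sum_i #|M i| <= \sum_i #|N i| + \sum_i (i != i0).
  by rewrite -big_split; exact: leq_sum.
have : \sum_i (i != i0) + 1 = #|I|.
  rewrite -sum1_card [RHS](bigD1 i0) //= addnC [in RHS]big_mkcond /=.
  by congr (1 + _); apply: eq_bigr => i _; case: eqP.
move: (\sum_i (i != i0)) => d; lia.
Qed.

End Bouquet.

(** * The graph [bouquet3] as an instance of the general bouquet *)

Lemma identify_proj_eq (G : sgraph) (A : {set G}) u v :
  identify_proj A u = identify_proj A v -> u = v \/ u \in A /\ v \in A.
Proof.
rewrite /identify_proj; case: insubP => [u' _ <-|/negPn uA];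
  case: insubP => [v' _ <-|/negPn vA] //.
  by case=> ->; left.
by right.
Qed.

Section Bouquet3.
Variables (G1 G2 G3 : sgraph) (x1 : G1) (x2 : G2) (x3 : G3).

(** The index type [bool + unit] mirrors the nesting [dunion (dunion G1 G2) G3]. *)
Definition bouquet3_part (i : bool + unit) : sgraph :=
  match i with inl true => G1 | inl false => G2 | inr tt => G3 end.

Definition bouquet3_root (i : bool + unit) : bouquet3_part i :=
  match i with inl true => x1 | inl false => x2 | inr tt => x3 end.

Definition bouquet3_inj (i : bool + unit) :
    bouquet3_part i -> dunion (dunion G1 G2) G3 :=
  match i with
  | inl true => fun v => inl (inl v)
  | inl false => fun v => inl (inr v)
  | inr tt => fun v => inr v
  end.

Definition bouquet3_roots : {set dunion (dunion G1 G2) G3} :=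
  [set inl (inl x1); inl (inr x2); inr x3].

Definition bouquet3_emb (i : bool + unit) (v : bouquet3_part i) :
    bouquet3 x1 x2 x3 :=
  identify_proj bouquet3_roots (bouquet3_inj v).

Lemma bouquet3_inj_roots i (v : bouquet3_part i) :
  (bouquet3_inj v \in bouquet3_roots) = (v == bouquet3_root i).
Proof. by case: i v => [[]|[]] v; rewrite !inE /eq_op /= ?orbF ?andbF. Qed.

Lemma bouquet3_inj_inj i : injective (@bouquet3_inj i).
Proof. by case: i => [[]|[]] u v []. Qed.

Lemma bouquet3_inj_tag i j (u : bouquet3_part i) (v : bouquet3_part j) :
  bouquet3_inj u = bouquet3_inj v -> i = j.
Proof. by case: i u => [[]|[]] u; case: j v => [[]|[]] v. Qed.

Lemma bouquet3_inj_adj i (u v : bouquet3_part i) :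
  adj (bouquet3_inj u) (bouquet3_inj v) = adj u v.
Proof. by case: i u v => [[]|[]]. Qed.

Lemma bouquet3_inj_edge u v : @adj (dunion (dunion G1 G2) G3) u v ->
  exists i (a b : bouquet3_part i),
    [/\ u = bouquet3_inj a, v = bouquet3_inj b & adj a b].
Proof.
case: u v => [[u|u]|u] [[v|v]|v] //= uv.
- by exists (inl true), u, v.
- by exists (inl false), u, v.
- by exists (inr tt), u, v.
Qed.

Lemma bouquet3_emb_inj i : injective (@bouquet3_emb i).
Proof.
move=> u v /identify_proj_eq[/bouquet3_inj_inj //|].
by rewrite !bouquet3_inj_roots => -[/eqP-> /eqP->].
Qed.

Lemma bouquet3_emb_meet i j (u : bouquet3_part i) (v : bouquet3_part j) :
  i != j -> bouquet3_emb u = bouquet3_emb v -> u = bouquet3_root i.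
Proof.
move=> ij /identify_proj_eq[/bouquet3_inj_tag/eqP|]; first by rewrite (negbTE ij).
by rewrite bouquet3_inj_roots => -[/eqP].
Qed.

Lemma bouquet3_emb_root i : bouquet3_emb (bouquet3_root i) = None.
Proof. by apply: insubF; rewrite bouquet3_inj_roots eqxx. Qed.

Lemma bouquet3_emb_edge (u v : bouquet3 x1 x2 x3) : adj u v ->
  exists i (a b : bouquet3_part i),
    [/\ u = bouquet3_emb a, v = bouquet3_emb b & adj a b].
Proof.
move=> /andP[_ /existsP[a /existsP[b /and3P[/eqP<- /eqP<-]]]].
by move=> /bouquet3_inj_edge[i [a' [b' [-> -> ab]]]]; exists i, a', b'.
Qed.

(** Identification adds no edge within a part: if an edge between [u] and [v] came from another
    part, both would be the root, and there are no loops. *)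
Lemma bouquet3_emb_adj i (u v : bouquet3_part i) :
  adj (bouquet3_emb u) (bouquet3_emb v) = adj u v.
Proof.
apply/idP/idP => uv.
  have [j [a [b [eu ev ab]]]] := bouquet3_emb_edge uv.
  have [ij | ij] := eqVneq i j.
    by subst j; rewrite (bouquet3_emb_inj eu) (bouquet3_emb_inj ev).
  move: uv; rewrite (bouquet3_emb_meet ij eu) (bouquet3_emb_meet ij ev).
  by rewrite adj_irr.
apply/andP; split.
  by apply: contraTneq uv => /bouquet3_emb_inj->; rewrite adj_irr.
apply/existsP; exists (bouquet3_inj u); apply/existsP; exists (bouquet3_inj v).
by rewrite !eqxx bouquet3_inj_adj.
Qed.

Lemma sum_bouquet3_part (F : sgraph -> nat) :
  \sum_i F (bouquet3_part i) = F G1 + F G2 + F G3.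
Proof.
by rewrite big_sumType big_bool (big_pred1 tt) //; case.
Qed.

Lemma card_bouquet3 : #|bouquet3 x1 x2 x3| + 2 = #|G1| + #|G2| + #|G3|.
Proof.
have <- : #|dunion (dunion G1 G2) G3| = #|G1| + #|G2| + #|G3|.
  by rewrite !card_sum.
rewrite -(cardsC bouquet3_roots) /bouquet3 card_option card_sig.
have -> : #|bouquet3_roots| = 3 by rewrite /bouquet3_roots -setUA !cardsU1 cards1 !inE.
have -> : #|[pred v | v \notin bouquet3_roots]| = #|~: bouquet3_roots|.
  by apply: eq_card => v; rewrite !inE.
lia.
Qed.

End Bouquet3.

Theorem theorem4p2 (G1 G2 G3 : sgraph)
    (conn1 : connected_graph G1) (conn2 : connected_graph G2)
    (conn3 : connected_graph G3)
    (x1 : G1) (x2 : G2) (x3 : G3) :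
  gamma_sp G1 + gamma_sp G2 + gamma_sp G3 - 2 <= gamma_sp (bouquet3 x1 x2 x3) /\
  gamma_sp (bouquet3 x1 x2 x3) <= gamma_sp G1 + gamma_sp G2 + gamma_sp G3.
Proof.
have cardI : #|{: bool + unit}| = 3 by rewrite card_sum card_bool card_unit.
have cardB : #|bouquet3 x1 x2 x3| + #|{: bool + unit}|
    = (\sum_i #|bouquet3_part G1 G2 G3 i|).+1.
  rewrite (sum_bouquet3_part _ _ _ (fun G => #|G|)) cardI -(card_bouquet3 x1 x2 x3).
  by rewrite addnS.
have edge (u v : bouquet3 x1 x2 x3) : adj u v ->
    exists i (a b : bouquet3_part G1 G2 G3 i),
      u = bouquet3_emb x1 x2 x3 a /\ v = bouquet3_emb x1 x2 x3 b.
  by move=> /bouquet3_emb_edge[i [a [b [-> -> _]]]]; exists i, a, b.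
rewrite -(sum_bouquet3_part _ _ _ gamma_sp); split.
  (* With three parts the bound reads [sum + 1 <= gamma_sp B + 3], which gives the truncated
     difference [sum - 2]. *)
  have := bouquet_gamma_sp_ge (@bouquet3_emb_inj _ _ _ x1 x2 x3)
    (@bouquet3_emb_adj _ _ _ x1 x2 x3) edge cardB.
  rewrite cardI; lia.
apply: (bouquet_gamma_sp_le (@bouquet3_emb_inj _ _ _ x1 x2 x3)
  (@bouquet3_emb_adj _ _ _ x1 x2 x3) (@bouquet3_emb_root _ _ _ x1 x2 x3)
  (@bouquet3_emb_meet _ _ _ x1 x2 x3) edge _ cardB).
by rewrite cardI.
Qed.
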